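(* Let $As_4^8$ be the four-dimensional complex associative algebra with basis $e_1,e_2,e_3,e_4$ and multiplication $e_1\cdot e_1=e_3,\ e_1\cdot e_3=e_4,\ e_2\cdot e_2=-e_4,\ e_3\cdot e_1=e_4$. Any four-dimensional complex anti-dendriform algebra associated to the algebra $As_4^8$ is isomorphic to one of the following pairwise non-isomorphic algebras (on the basis $e_1,e_2,e_3,e_4$, with $\alpha,\beta\in\mathbb{C}$): $AD_4^{19}(\alpha)$: $e_1\vartriangleright e_1=\frac12 e_3,\ e_1\vartriangleright e_3=2e_4,\ e_2\vartriangleright e_2=(-1+\alpha)e_4,\ e_3\vartriangleright e_1=-e_4,\ e_1\vartriangleleft e_1=\frac12 e_3,\ e_1\vartriangleleft e_3=-e_4,\ e_2\vartriangleleft e_2=-\alpha e_4,\ e_3\vartriangleleft e_1=2e_4$; $AD_4^{20}(\alpha)$, $\alpha\neq-1$: $e_1\vartriangleright e_1=\frac12 e_3,\ e_1\vartriangleright e_3=2e_4,\ e_2\vartriangleright e_1=e_4,\ e_2\vartriangleright e_2=(-1+\alpha)e_4,\ e_3\vartriangleright e_1=-e_4,\ e_1\vartriangleleft e_1=\frac12 e_3,\ e_1\vartriangleleft e_3=-e_4,\ e_2\vartriangleleft e_1=-e_4,\ e_2\vartriangleleft e_2=-\alpha e_4,\ e_3\vartriangleleft e_1=2e_4$; $AD_4^{21}(\alpha,\beta)$, $\beta\neq-1$: $e_1\vartriangleright e_1=\frac12 e_3+e_4,\ e_1\vartriangleright e_3=2e_4,\ e_2\vartriangleright e_1=\alpha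 e_4,\ e_2\vartriangleright e_2=(-1+\beta)e_4,\ e_3\vartriangleright e_1=-e_4,\ e_1\vartriangleleft e_1=\frac12 e_3-e_4,\ e_1\vartriangleleft e_3=-e_4,\ e_2\vartriangleleft e_1=-\alpha e_4,\ e_2\vartriangleleft e_2=-\beta e_4,\ e_3\vartriangleleft e_1=2e_4$; $AD_4^{22}$: $e_1\vartriangleright e_1=\frac12 e_3,\ e_1\vartriangleright e_2=e_4,\ e_1\vartriangleright e_3=2e_4,\ e_2\vartriangleright e_2=-2e_4,\ e_3\vartriangleright e_1=-e_4,\ e_1\vartriangleleft e_1=\frac12 e_3,\ e_1\vartriangleleft e_2=-e_4,\ e_1\vartriangleleft e_3=-e_4,\ e_2\vartriangleleft e_2=e_4,\ e_3\vartriangleleft e_1=2e_4$; $AD_4^{23}(\alpha)$: $e_1\vartriangleright e_1=\frac12 e_3+e_4,\ e_1\vartriangleright e_2=\alpha e_4,\ e_1\vartriangleright e_3=2e_4,\ e_2\vartriangleright e_2=-2e_4,\ e_3\vartriangleright e_1=-e_4,\ e_1\vartriangleleft e_1=\frac12 e_3-e_4,\ e_1\vartriangleleft e_2=-\alpha e_4,\ e_1\vartriangleleft e_3=-e_4,\ e_2\vartriangleleft e_2=e_4,\ e_3\vartriangleleft e_1=2e_4$.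
   Context: All vector spaces and algebras are finite-dimensional over $\mathbb{C}$. An anti-dendriform algebra is a vector space $A$ with two bilinear operations $\vartriangleright,\vartriangleleft: A\otimes A\to A$ such that, writing $x\cdot y=x\vartriangleright y+x\vartriangleleft y$, for all $x,y,z\in A$: $(x\vartriangleright y)\vartriangleleft z=x\vartriangleright(y\vartriangleleft z)$ and $x\vartriangleright(y\vartriangleright z)=-(x\cdot y)\vartriangleright z=-x\vartriangleleft(y\cdot z)=(x\vartriangleleft y)\vartriangleleft z$. Then $(A,\cdot)$ is an associative algebra, called the associated associative algebra of $(A,\vartriangleright,\vartriangleleft)$. An anti-dendriform algebra is ''associated to'' an associative algebra $B$ if its associated associative algebra is $B$ (up to isomorphism). Isomorphisms of anti-dendriform algebras are linear bijections preserving both $\vartriangleright$ and $\vartriangleleft$. In multiplication tables, all products of basis elements that are not listed are zero.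
   Formalization: Pairwise non-isomorphism is asserted except between α and -α in AD_4^{21}(α,β) (same β) and in AD_4^{23}(α): e_2 ↦ -e_2 gives AD_4^{21}(α,β) ≅ AD_4^{21}(-α,β) and AD_4^{23}(α) ≅ AD_4^{23}(-α), so the literal claim fails there. *)

(* Defs.v *)
From HB Require Import structures.
From mathcomp Require Import all_boot all_order all_algebra.
From mathcomp Require Import ring.
From mathcomp Require Import reals complex.

Set Implicit Arguments.
Unset Strict Implicit.
Unset Printing Implicit Defensive.

Import GRing.Theory Num.Theory.
Local Open Scope ring_scope.

(* Algebras are not required to have a unit, hence the library's [falgType],
   which is unital, is not used. *)
Record assocAlgebra (K : fieldType) (V : vectType K) := AssocAlgebra {
  assoc_mul : {bilinear V -> V -> V};
  assoc_mulA : associative assoc_mul }.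

Definition assoc_iso (K : fieldType) (V W : vectType K)
    (A : assocAlgebra V) (B : assocAlgebra W) : Prop :=
  exists2 f : {linear V -> W}, bijective f &
    forall x y, f (assoc_mul A x y) = assoc_mul B (f x) (f y).

Definition sum_op (K : fieldType) (V : vectType K) (r l : V -> V -> V)
  (x y : V) : V := r x y + l x y.

Record antiDendriform (K : fieldType) (V : vectType K) := AntiDendriform {
  rprod : {bilinear V -> V -> V};
  lprod : {bilinear V -> V -> V};
  rprod_lprod : forall x y z, lprod (rprod x y) z = rprod x (lprod y z);
  rprod_rprod : forall x y z,
    rprod x (rprod y z) = - rprod (sum_op rprod lprod x y) z;
  rprod_sum : forall x y z,
    - rprod (sum_op rprod lprod x y) z = - lprod x (sum_op rprod lprod y z);
  lprod_sum : forall x y z,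
    - lprod x (sum_op rprod lprod y z) = lprod (lprod x y) z }.

Definition ad_iso (K : fieldType) (V W : vectType K)
    (A : antiDendriform V) (B : antiDendriform W) : Prop :=
  exists2 f : {linear V -> W}, bijective f &
    (forall x y, f (rprod A x y) = rprod B (f x) (f y)) /\
    (forall x y, f (lprod A x y) = lprod B (f x) (f y)).

Section AssociatedAlgebra.
Variables (K : fieldType) (V : vectType K) (A : antiDendriform V).

Definition ad_mul : V -> V -> V := sum_op (rprod A) (lprod A).

Fact ad_mul_bilinear : bilinear_for *:%R *:%R ad_mul.
Proof.
split=> u a x y; rewrite /= /ad_mul /sum_op.
  by rewrite !linearPl scalerDr addrACA.
by rewrite !linearPr scalerDr addrACA.
Qed.

HB.instance Definition _ :=
  bilinear_isBilinear.Build K V V V *:%R *:%R ad_mul ad_mul_bilinear.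

Fact ad_mulA : associative ad_mul.
Proof.
move=> x y z; rewrite {1}/ad_mul {1}/sum_op [RHS]/ad_mul [RHS]/sum_op addrC.
have -> : lprod A x (ad_mul y z) = rprod A (ad_mul x y) z.
  by apply: oppr_inj; rewrite -rprod_sum.
congr (_ + _).
rewrite {1}/ad_mul {1}/sum_op linearDr /= -rprod_lprod rprod_rprod rprod_sum.
by rewrite lprod_sum /ad_mul /sum_op linearDl /= addrC.
Qed.

Definition associated_algebra : assocAlgebra V := AssocAlgebra ad_mulA.

End AssociatedAlgebra.

Definition associated_to (K : fieldType) (V W : vectType K)
  (A : antiDendriform V) (B : assocAlgebra W) : Prop :=
  assoc_iso (associated_algebra A) B.

Section Tables.
Variable K : numFieldType.
Local Notation E := 'rV[K]_4.

(* Basis vectors and coordinates are numbered from 1 to 4. *)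
Definition e (k : nat) : E := delta_mx 0 (inord k.-1).
Definition co (k : nat) (x : E) : K := x 0 (inord k.-1).

(* [entry i j v] in a multiplication table says that the product of
   [e i] and [e j] is [v]; the products which are not listed are zero. *)
Definition table := seq (nat * nat * E).

Definition entry (i j : nat) (v : E) : nat * nat * E := (i, j, v).

Definition table_mul (s : table) (x y : E) : E :=
  \sum_(t <- s) (co t.1.1 x * co t.1.2 y) *: t.2.

Fact table_mul_bilinear s : bilinear_for *:%R *:%R (table_mul s).
Proof.
split=> u a x y; rewrite /= /table_mul scaler_sumr -big_split /=;
  apply: eq_bigr => t _; rewrite scalerA -scalerDl; congr (_ *: _);
  rewrite /co !mxE; ring.
Qed.

HB.instance Definition _ s :=
  bilinear_isBilinear.Build K E E E *:%R *:%R (table_mul s)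
    (table_mul_bilinear s).

Lemma rowP4 (x y : E) : co 1 x = co 1 y -> co 2 x = co 2 y ->
  co 3 x = co 3 y -> co 4 x = co 4 y -> x = y.
Proof.
move=> h1 h2 h3 h4; apply/rowP => -[[|[|[|[|m]]]] lt_m] //.
- by move: h1; rewrite /co; congr (x _ _ = y _ _); apply: val_inj; rewrite /= inordK.
- by move: h2; rewrite /co; congr (x _ _ = y _ _); apply: val_inj; rewrite /= inordK.
- by move: h3; rewrite /co; congr (x _ _ = y _ _); apply: val_inj; rewrite /= inordK.
- by move: h4; rewrite /co; congr (x _ _ = y _ _); apply: val_inj; rewrite /= inordK.
Qed.

Lemma co_e k m : (k.-1 < 4)%N -> (m.-1 < 4)%N ->
  co k (e m) = (k.-1 == m.-1)%:R.
Proof. by move=> hk hm; rewrite /co /e !mxE eqxx -val_eqE /= !inordK. Qed.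

Lemma coD k x y : co k (x + y) = co k x + co k y.
Proof. by rewrite /co mxE. Qed.
Lemma coN k x : co k (- x) = - co k x.
Proof. by rewrite /co mxE. Qed.
Lemma coZ k a x : co k (a *: x) = a * co k x.
Proof. by rewrite /co mxE. Qed.

Lemma co_table_mul k s x y : co k (table_mul s x y) =
  \sum_(t <- s) co t.1.1 x * co t.1.2 y * co k t.2.
Proof.
rewrite /co /table_mul summxE; apply: eq_bigr => t _.
by rewrite mxE.
Qed.

Definition coE := (co_table_mul, big_cons, big_nil, coD, coN, coZ).

Definition As48_table : table :=
  [:: entry 1 1 (e 3); entry 1 3 (e 4); entry 2 2 (- e 4); entry 3 1 (e 4)].

Definition product_form (op : E -> E -> E) (t p q c r s d : K) : Prop :=
  forall x y, [/\ co 1 (op x y) = 0, co 2 (op x y) = 0,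
    co 3 (op x y) = t * (co 1 x * co 1 y) &
    co 4 (op x y) = p * (co 1 x * co 1 y) + q * (co 1 x * co 2 y) +
      c * (co 1 x * co 3 y) + r * (co 2 x * co 1 y) + s * (co 2 x * co 2 y) +
      d * (co 3 x * co 1 y)].

Local Ltac form_tac := move=> x y; split; rewrite /= !coE /= !co_e //=; by ring.

Local Ltac form_rw H := do ?[rewrite (let: And4 h _ _ _ := H _ _ in h)
  | rewrite (let: And4 _ h _ _ := H _ _ in h)
  | rewrite (let: And4 _ _ h _ := H _ _ in h)
  | rewrite (let: And4 _ _ _ h := H _ _ in h)].

Fact As48_form : product_form (table_mul As48_table) 1 0 0 1 0 (-1) 1.
Proof. form_tac. Qed.

Fact As48_mulA : associative (table_mul As48_table).
Proof.
by move=> x y z; apply: rowP4; form_rw As48_form; ring.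
Qed.

Definition As48 : assocAlgebra E := AssocAlgebra As48_mulA.

Definition AD19_r (a : K) : table :=
  [:: entry 1 1 (2^-1 *: e 3); entry 1 3 (2 *: e 4);
      entry 2 2 ((-1 + a) *: e 4); entry 3 1 (- e 4)].
Definition AD19_l (a : K) : table :=
  [:: entry 1 1 (2^-1 *: e 3); entry 1 3 (- e 4);
      entry 2 2 (- a *: e 4); entry 3 1 (2 *: e 4)].

Definition AD20_r (a : K) : table :=
  [:: entry 1 1 (2^-1 *: e 3); entry 1 3 (2 *: e 4); entry 2 1 (e 4);
      entry 2 2 ((-1 + a) *: e 4); entry 3 1 (- e 4)].
Definition AD20_l (a : K) : table :=
  [:: entry 1 1 (2^-1 *: e 3); entry 1 3 (- e 4); entry 2 1 (- e 4);
      entry 2 2 (- a *: e 4); entry 3 1 (2 *: e 4)].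

Definition AD21_r (a b : K) : table :=
  [:: entry 1 1 (2^-1 *: e 3 + e 4); entry 1 3 (2 *: e 4);
      entry 2 1 (a *: e 4); entry 2 2 ((-1 + b) *: e 4); entry 3 1 (- e 4)].
Definition AD21_l (a b : K) : table :=
  [:: entry 1 1 (2^-1 *: e 3 - e 4); entry 1 3 (- e 4);
      entry 2 1 (- a *: e 4); entry 2 2 (- b *: e 4); entry 3 1 (2 *: e 4)].

Definition AD22_r : table :=
  [:: entry 1 1 (2^-1 *: e 3); entry 1 2 (e 4); entry 1 3 (2 *: e 4);
      entry 2 2 (- 2 *: e 4); entry 3 1 (- e 4)].
Definition AD22_l : table :=
  [:: entry 1 1 (2^-1 *: e 3); entry 1 2 (- e 4); entry 1 3 (- e 4);
      entry 2 2 (e 4); entry 3 1 (2 *: e 4)].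

Definition AD23_r (a : K) : table :=
  [:: entry 1 1 (2^-1 *: e 3 + e 4); entry 1 2 (a *: e 4);
      entry 1 3 (2 *: e 4); entry 2 2 (- 2 *: e 4); entry 3 1 (- e 4)].
Definition AD23_l (a : K) : table :=
  [:: entry 1 1 (2^-1 *: e 3 - e 4); entry 1 2 (- a *: e 4);
      entry 1 3 (- e 4); entry 2 2 (e 4); entry 3 1 (2 *: e 4)].

Section TableAD.
Variables (r l : table) (p q a b : K).
Hypothesis hr : product_form (table_mul r) 2^-1 p q 2 a (-1 + b) (-1).
Hypothesis hl : product_form (table_mul l) 2^-1 (- p) (- q) (-1) (- a) (- b) 2.

Local Notation R := (table_mul r).
Local Notation L := (table_mul l).

Local Ltac ad_axiom := move=> x y z; apply: rowP4;
  rewrite /sum_op ?coN; form_rw hr; form_rw hl; rewrite ?coD;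
  form_rw hr; form_rw hl; by field; rewrite ?pnatr_eq0.

Fact table_rprod_lprod x y z : L (R x y) z = R x (L y z).
Proof. move: x y z; ad_axiom. Qed.

Fact table_rprod_rprod x y z : R x (R y z) = - R (sum_op R L x y) z.
Proof. move: x y z; ad_axiom. Qed.

Fact table_rprod_sum x y z :
  - R (sum_op R L x y) z = - L x (sum_op R L y z).
Proof. move: x y z; ad_axiom. Qed.

Fact table_lprod_sum x y z : - L x (sum_op R L y z) = L (L x y) z.
Proof. move: x y z; ad_axiom. Qed.

Definition tableAD : antiDendriform E :=
  @AntiDendriform K E (table_mul r) (table_mul l)
    table_rprod_lprod table_rprod_rprod table_rprod_sum table_lprod_sum.

Fact tableAD_associated : associated_to tableAD As48.
Proof.
exists idfun; first by exists idfun.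
move=> x y; apply: rowP4; form_rw As48_form;
  rewrite /= /ad_mul /sum_op /= ?coD; form_rw hr; form_rw hl;
  by field; rewrite ?pnatr_eq0.
Qed.

End TableAD.

Fact AD19_r_form (a : K) :
  product_form (table_mul (AD19_r a)) 2^-1 0 0 2 0 (-1 + a) (-1).
Proof. form_tac. Qed.

Fact AD19_l_form (a : K) :
  product_form (table_mul (AD19_l a)) 2^-1 (- 0) (- 0) (-1) (- 0) (- a) 2.
Proof. form_tac. Qed.

Definition AD19 (a : K) : antiDendriform E :=
  @tableAD (AD19_r a) (AD19_l a) _ _ _ _ (AD19_r_form a) (AD19_l_form a).

Fact AD20_r_form (a : K) :
  product_form (table_mul (AD20_r a)) 2^-1 0 0 2 1 (-1 + a) (-1).
Proof. form_tac. Qed.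

Fact AD20_l_form (a : K) :
  product_form (table_mul (AD20_l a)) 2^-1 (- 0) (- 0) (-1) (- 1) (- a) 2.
Proof. form_tac. Qed.

Definition AD20 (a : K) : antiDendriform E :=
  @tableAD (AD20_r a) (AD20_l a) _ _ _ _ (AD20_r_form a) (AD20_l_form a).

Fact AD21_r_form (a b : K) :
  product_form (table_mul (AD21_r a b)) 2^-1 1 0 2 a (-1 + b) (-1).
Proof. form_tac. Qed.

Fact AD21_l_form (a b : K) :
  product_form (table_mul (AD21_l a b)) 2^-1 (- 1) (- 0) (-1) (- a) (- b) 2.
Proof. form_tac. Qed.

Definition AD21 (a b : K) : antiDendriform E :=
  @tableAD (AD21_r a b) (AD21_l a b) _ _ _ _ (AD21_r_form a b) (AD21_l_form a b).

Fact AD22_r_form :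
  product_form (table_mul AD22_r) 2^-1 0 1 2 0 (-1 + (-1)) (-1).
Proof. form_tac. Qed.

Fact AD22_l_form :
  product_form (table_mul AD22_l) 2^-1 (- 0) (- 1) (-1) (- 0) (- (-1)) 2.
Proof. form_tac. Qed.

Definition AD22 : antiDendriform E :=
  @tableAD AD22_r AD22_l _ _ _ _ AD22_r_form AD22_l_form.

Fact AD23_r_form (a : K) :
  product_form (table_mul (AD23_r a)) 2^-1 1 a 2 0 (-1 + (-1)) (-1).
Proof. form_tac. Qed.

Fact AD23_l_form (a : K) :
  product_form (table_mul (AD23_l a)) 2^-1 (- 1) (- a) (-1) (- 0) (- (-1)) 2.
Proof. form_tac. Qed.

Definition AD23 (a : K) : antiDendriform E :=
  @tableAD (AD23_r a) (AD23_l a) _ _ _ _ (AD23_r_form a) (AD23_l_form a).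

Inductive listed :=
  | L19 of K | L20 of K | L21 of K & K | L22 | L23 of K.

Definition admissible (t : listed) : bool :=
  match t with
  | L20 a => a != -1
  | L21 _ b => b != -1
  | _ => true
  end.

Definition AD (t : listed) : antiDendriform E :=
  match t with
  | L19 a => AD19 a
  | L20 a => AD20 a
  | L21 a b => AD21 a b
  | L22 => AD22
  | L23 a => AD23 a
  end.

(* The list is not literally free of repetitions: [e 2 |-> - e 2] is an
   isomorphism from [AD21 a b] to [AD21 (- a) b] and from [AD23 a] to
   [AD23 (- a)] (see [AD21_opp] and [AD23_opp]).  So [a] is to be read up to
   sign in these two families. *)
Definition same_listed (t u : listed) : Prop :=
  match t, u with
  | L19 a, L19 a' => a = a'
  | L20 a, L20 a' => a = a'
  | L21 a b, L21 a' b' => (a = a' \/ a = - a') /\ b = b'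
  | L22, L22 => True
  | L23 a, L23 a' => a = a' \/ a = - a'
  | _, _ => False
  end.

Lemma AD_associated (t : listed) : associated_to (AD t) As48.
Proof. by case: t => *; apply: tableAD_associated. Qed.

Let sgn2 : 'M[K]_4 := diag_mx (const_mx 1 - 2 *: e 2).

Let co_sgn2 k (x : E) : (k.-1 < 4)%N ->
  co k (mulmxr sgn2 x) = (if k.-1 == 1 then - 1 else 1) * co k x.
Proof.
move=> hk; rewrite /= /sgn2 /co mul_mx_diag !mxE eqxx -val_eqE /= !inordK //.
by case: (k.-1 == 1)%N; rewrite /=; ring.
Qed.

Let sgn2_bij : bijective (mulmxr sgn2 : E -> E).
Proof.
by exists (mulmxr sgn2) => x; apply: rowP4; rewrite !co_sgn2 //=; ring.
Qed.

Lemma AD21_opp (a b : K) : ad_iso (AD21 a b) (AD21 (- a) b).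
Proof.
exists (mulmxr sgn2); first exact: sgn2_bij.
split=> x y; apply: rowP4; rewrite co_sgn2 //;
  try rewrite [rprod _]/=; try rewrite [lprod _]/=.
all: form_rw (AD21_r_form a b); form_rw (AD21_r_form (- a) b).
all: form_rw (AD21_l_form a b); form_rw (AD21_l_form (- a) b).
all: by rewrite ?co_sgn2 //=; ring.
Qed.

Lemma AD23_opp (a : K) : ad_iso (AD23 a) (AD23 (- a)).
Proof.
exists (mulmxr sgn2); first exact: sgn2_bij.
split=> x y; apply: rowP4; rewrite co_sgn2 //;
  try rewrite [rprod _]/=; try rewrite [lprod _]/=.
all: form_rw (AD23_r_form a); form_rw (AD23_r_form (- a)).
all: form_rw (AD23_l_form a); form_rw (AD23_l_form (- a)).
all: by rewrite ?co_sgn2 //=; ring.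
Qed.

End Tables.

(* Main.v *)
Require Import Defs.
From HB Require Import structures.
From mathcomp Require Import all_boot all_order all_algebra.
From mathcomp Require Import ring.
From mathcomp Require Import reals complex.
Local Open Scope ring_scope.

Set Implicit Arguments.
Unset Strict Implicit.
Unset Printing Implicit Defensive.

Import GRing.Theory Num.Theory.

(** Write [R], [L] for the two operations and [xy] for their sum.

    Structure.  The axioms imply [R x (yz) = L (xy) z], [L x (yz) = R (xy) z]
    and [L (R x y) z = xyz].  Hence products of three elements are killed by
    [R] and [L] as soon as all products of four elements vanish, and
    [R x y] squares to [(xy)(R x y) - R ((R x y) x) y].  For the algebra As48
    this square formula forces the [e 1]-coordinate of every [R x y] to vanish
    (it squares to zero; one treats [R (e 1) (e 3)] first, in order to control
    the last term), then the identity [e 2 * e 2 = - e 4] removes the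
    [e 2]-coordinate.  What is left is [R (e 1) (e 3) = k e 4], and comparing
    [R (e 1) (R (e 1) (e 1)) = - R (e 3) (e 1)] with
    [L (R (e 1) (e 1)) (e 1) = e 4] gives [k = 2].  So the structure is given
    by four scalars [p, q, r, b], which record the [e 4]-coordinates of the
    values of [R] on [e 1] and [e 2] ([ad_form_As48]).

    Isomorphisms.  An isomorphism between two such structures preserves the
    product of As48, hence sends [e 1] to [t^2 e 1 + t^3 m e 2] and [e 2] to
    [t^3 e 2 + t^4 m e 3], up to terms which do not act on the scalars.  It
    preserves [b], and changes [q] into [t (q - (b + 1) m)], [r] into
    [t (r - (b - 2) m)] and [p] by a formula quadratic in [m]
    ([ad_form_iso]).

    Classification.  If [b != -1], the shear [m] kills [q] and is then used
    up, so that [t] acts on [(p, r)] with weights [(2, 1)]: this gives the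
    families 19, 20 and 21.  If [b = -1], then [q] cannot be moved by [m], but
    [r] can be killed because [b - 2 = -3]; now [t] acts on [(p, q)] with
    weights [(2, 1)], which gives 19, 22 and 23.  The sign ambiguity in the
    families 21 and 23 is that of the square root which scales [p] to [1]. *)

(** * Consequences of the axioms *)

Section Identities.
Variables (K : fieldType) (V : vectType K) (A : antiDendriform V).
Local Notation R := (rprod A).
Local Notation L := (lprod A).
Local Notation M := (ad_mul A).

Lemma rprod_rprodE x y z : R x (R y z) = - R (M x y) z.
Proof. exact: rprod_rprod. Qed.

Lemma lprod_mul x y z : L x (M y z) = R (M x y) z.
Proof. by apply: oppr_inj; rewrite -rprod_sum. Qed.

Lemma lprod_lprodE x y z : L (L x y) z = - R (M x y) z.
Proof. by rewrite -lprod_sum rprod_sum. Qed.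

Lemma ad_mulE x y : M x y = R x y + L x y.
Proof. by []. Qed.

Lemma rprod_mul x y z : R x (M y z) = L (M x y) z.
Proof.
rewrite [M y z]ad_mulE linearDr /= rprod_rprodE -rprod_lprod.
by rewrite [in RHS]ad_mulE [RHS]linearDl /= lprod_lprodE addrC.
Qed.

Lemma lprod_rprodE x y z : L (R x y) z = M (M x y) z.
Proof.
have -> : M (M x y) z = R (M x y) z + (L (R x y) z + L (L x y) z).
  by congr (_ + _); exact: linearDl.
by rewrite lprod_lprodE addrCA subrr addr0.
Qed.

(** Four-fold products split evenly between the two operations: bracketing
    [xyzw] in the two possible ways moves it from [L] to [R]. *)
Lemma lprod_cube x y z w : L (M (M x y) z) w = R (M (M x y) z) w.
Proof. by rewrite -rprod_mul -lprod_mul ad_mulA lprod_mul ad_mulA. Qed.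

(** The axioms express both [L (R x y)] and [R _ (R x y)] through products of
    the associative algebra.  In a nilpotent algebra both terms on the right
    are small, which bounds the values of [R]. *)
Lemma rprod_sqr x y :
  M (R x y) (R x y) = M (M x y) (R x y) - R (M (R x y) x) y.
Proof.
by rewrite [LHS]ad_mulE lprod_rprodE rprod_rprodE addrC.
Qed.

End Identities.

(** * Transport along a linear bijection *)

Lemma ad_iso_trans (K : fieldType) (U V W : vectType K)
  (A : antiDendriform U) (B : antiDendriform V) (C : antiDendriform W) :
  ad_iso A B -> ad_iso B C -> ad_iso A C.
Proof.
move=> [f bf [fr fl]] [g bg [gr gl]]; exists (g \o f).
  exact: bij_comp.
by split=> x y /=; rewrite ?fr ?fl ?gr ?gl.
Qed.

Section Transport.
Variables (K : fieldType) (V W : vectType K).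
Variables (f : {linear V -> W}) (g : W -> V).
Hypotheses (fK : cancel f g) (gK : cancel g f).

Definition transport_op (op : V -> V -> V) (x y : W) : W := f (op (g x) (g y)).

Fact transport_op_bilinear (op : {bilinear V -> V -> V}) :
  bilinear_for *:%R *:%R (transport_op op).
Proof.
have gP a x y : g (a *: x + y) = a *: g x + g y.
  by apply: (can_inj fK); rewrite linearP !gK.
by split=> u a x y; rewrite /= /transport_op gP ?linearPl ?linearPr linearP.
Qed.

HB.instance Definition _ (op : {bilinear V -> V -> V}) :=
  bilinear_isBilinear.Build K W W W *:%R *:%R (transport_op op)
    (transport_op_bilinear op).

Lemma ad_transport (A : antiDendriform V) :
  exists B : antiDendriform W,
    [/\ forall x y, f (rprod A x y) = rprod B (f x) (f y),
        forall x y, f (lprod A x y) = lprod B (f x) (f y) & ad_iso A B].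
Proof.
pose r : {bilinear W -> W -> W} := transport_op (rprod A).
pose l : {bilinear W -> W -> W} := transport_op (lprod A).
have rE x y : r x y = f (rprod A (g x) (g y)) by [].
have lE x y : l x y = f (lprod A (g x) (g y)) by [].
have sE x y : sum_op r l x y = f (sum_op (rprod A) (lprod A) (g x) (g y)).
  by rewrite /sum_op rE lE linearD.
have h1 x y z : l (r x y) z = r x (l y z).
  by rewrite !(rE, lE) !fK rprod_lprod.
have h2 x y z : r x (r y z) = - r (sum_op r l x y) z.
  by rewrite !(rE, sE) !fK rprod_rprod raddfN.
have h3 x y z : - r (sum_op r l x y) z = - l x (sum_op r l y z).
  by rewrite !(rE, lE, sE) !fK -!(raddfN f) rprod_sum.
have h4 x y z : - l x (sum_op r l y z) = l (l x y) z.
  by rewrite !(lE, sE) !fK -!(raddfN f) lprod_sum.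
pose B := AntiDendriform h1 h2 h3 h4.
have hr x y : f (rprod A x y) = rprod B (f x) (f y) by rewrite /= rE !fK.
have hl x y : f (lprod A x y) = lprod B (f x) (f y) by rewrite /= lE !fK.
by exists B; split=> //; exists f => //; exists g.
Qed.

End Transport.

(** * Anti-dendriform structures on the algebra As48 *)

Section Structure.
Variable K : numFieldType.
Local Notation E := 'rV[K]_4.
Local Notation e := (@e K).

(** The scalars [2^-1], [2] and [-1] are forced by the axioms; [- p], [- q],
    [- r], [- b] make the two operations add up to the product of As48, and
    [b] is shifted so that it is the parameter of the listed families. *)
Definition ad_form (B : antiDendriform E) (p q r b : K) : Prop :=
  product_form (rprod B) 2^-1 p q 2 r (-1 + b) (-1) /\
  product_form (lprod B) 2^-1 (- p) (- q) (-1) (- r) (- b) 2.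

Lemma row4E (x : E) :
  x = co 1 x *: e 1 + co 2 x *: e 2 + co 3 x *: e 3 + co 4 x *: e 4.
Proof. by apply: rowP4; rewrite !coE !co_e //=; ring. Qed.

Lemma co0 k : co k (0 : E) = 0.
Proof. by rewrite /co mxE. Qed.

Variable B : antiDendriform E.
Local Notation R := (rprod B).
Local Notation L := (lprod B).
Local Notation M := (ad_mul B).
Hypothesis mulE : forall x y, M x y = table_mul (As48_table K) x y.

Let M1 x y : co 1 (M x y) = 0.
Proof. by rewrite mulE; case: (As48_form x y). Qed.
Let M2 x y : co 2 (M x y) = 0.
Proof. by rewrite mulE; case: (As48_form x y). Qed.
Let M3 x y : co 3 (M x y) = co 1 x * co 1 y.
Proof. by rewrite mulE; case: (As48_form x y) => _ _ -> _; ring. Qed.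
Let M4 x y : co 4 (M x y) =
  co 1 x * co 3 y - co 2 x * co 2 y + co 3 x * co 1 y.
Proof. by rewrite mulE; case: (As48_form x y) => _ _ _ ->; ring. Qed.
Let ME := (M1, M2, M3, M4).

Let LE x y : L x y = M x y - R x y.
Proof. by rewrite ad_mulE addrC addKr. Qed.

Local Ltac coords := apply: rowP4; rewrite ?(ME, coE) ?co_e //= ?co0; by ring.

Let e3E : e 3 = M (e 1) (e 1). Proof. by coords. Qed.
Let e4E : e 4 = M (M (e 1) (e 1)) (e 1). Proof. by coords. Qed.
Let m4x x : M (e 4) x = 0. Proof. by coords. Qed.
Let m21 : M (e 2) (e 1) = 0. Proof. by coords. Qed.
Let m12 : M (e 1) (e 2) = 0. Proof. by coords. Qed.
Let m31 : M (e 3) (e 1) = e 4. Proof. by coords. Qed.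
Let m13 : M (e 1) (e 3) = e 4. Proof. by coords. Qed.

(* [lprod_cube] says that the two operations agree here, and their sum, a
   product of four elements, vanishes in As48; divide by 2. *)
Let cube0 x y z w : R (M (M x y) z) w = 0 /\ L (M (M x y) z) w = 0.
Proof.
rewrite lprod_cube; suff -> : R (M (M x y) z) w = 0 by [].
have : M (M (M x y) z) w = 0 by coords.
rewrite ad_mulE lprod_cube -mulr2n => /eqP.
by rewrite -scaler_nat scaler_eq0 pnatr_eq0 => /eqP.
Qed.

Let r4x x : R (e 4) x = 0.
Proof. by rewrite e4E; case: (cube0 (e 1) (e 1) (e 1) x). Qed.
Let l4x x : L (e 4) x = 0.
Proof. by rewrite e4E; case: (cube0 (e 1) (e 1) (e 1) x). Qed.
Let lx4 x : L x (e 4) = 0.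
Proof.
rewrite e4E -ad_mulA lprod_mul rprod_mul.
by case: (cube0 x (e 1) (e 1) (e 1)).
Qed.
Let rx4 x : R x (e 4) = 0.
Proof.
rewrite e4E rprod_mul ad_mulA.
by case: (cube0 x (e 1) (e 1) (e 1)).
Qed.

Let r23 : R (e 2) (e 3) = 0.
Proof. by rewrite e3E rprod_mul m21 linear0l. Qed.
Let r32 : R (e 3) (e 2) = 0.
Proof. by rewrite e3E -lprod_mul m12 linear0r. Qed.
Let l32 : L (e 3) (e 2) = 0.
Proof. by rewrite e3E -rprod_mul m12 linear0r. Qed.
Let r33 : R (e 3) (e 3) = 0.
Proof. by rewrite [X in R X _]e3E -lprod_mul m13 lx4. Qed.

Let row34 (w : E) : co 1 w = 0 -> co 2 w = 0 ->
  w = co 3 w *: e 3 + co 4 w *: e 4.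
Proof. by move=> h1 h2; rewrite {1}[w]row4E h1 h2 !scale0r !add0r. Qed.

(** The hypothesis removes the last term of [rprod_sqr] in coordinate 3, where
    the square of [w := R x y] has coordinate [(co 1 w)^2].  Then [w] lies in
    the span of [e 2], [e 3], [e 4], and [R (e 2) w = L w (e 2) = 0], which
    are [co 2 w] times [R (e 2) (e 2)] and [L (e 2) (e 2)], whose sum is
    [- e 4]. *)
Let rprod_co12 x y :
  co 3 (R (M (R x y) x) y) = 0 -> co 1 (R x y) = 0 /\ co 2 (R x y) = 0.
Proof.
move=> h3; set w := R x y.
have w1 : co 1 w = 0.
  have /(congr1 (co 3)) := rprod_sqr B x y.
  rewrite -/w [RHS]coD [in RHS]coN h3 !ME mul0r subr0 => /eqP.
  by rewrite mulf_eq0 orbb => /eqP.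
split=> //.
have wE : w = co 2 w *: e 2 + co 3 w *: e 3 + co 4 w *: e 4.
  by rewrite {1}[w]row4E w1 scale0r add0r.
have r2w : R (e 2) w = 0.
  rewrite /w rprod_rprodE; have -> : M (e 2) x = - co 2 x *: e 4 by coords.
  by rewrite linearZl_LR /= r4x scaler0 oppr0.
have lw2 : L w (e 2) = 0.
  by rewrite /w lprod_rprodE; coords.
have : co 2 w *: M (e 2) (e 2) = 0.
  rewrite ad_mulE scalerDr.
  have -> : co 2 w *: R (e 2) (e 2) = 0.
    rewrite -r2w [X in _ = R _ X]wE !linearDr !linearZr_LR /= r23 rx4.
    by rewrite !scaler0 !addr0.
  have -> : co 2 w *: L (e 2) (e 2) = 0.
    rewrite -lw2 [X in _ = L X _]wE !linearDl !linearZl_LR /= l32 l4x.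
    by rewrite !scaler0 !addr0.
  by rewrite addr0.
move/(congr1 (co 4)); rewrite coZ !ME !co_e //= co0 => /eqP.
rewrite mulf_eq0 => /orP[/eqP //|].
by rewrite !mulr0 mulr1 sub0r addr0 oppr_eq0 oner_eq0.
Qed.

(** [R (e 3) (e 3) = 0] provides the hypothesis of [rprod_co12] for
    [u := R (e 1) (e 3)].  Its [e 3]-coordinate vanishes since
    [L (e 3) (e 1) = u], hence [0 = L u (e 1) = co 3 u *: u]. *)
Let r13 : exists k, R (e 1) (e 3) = k *: e 4.
Proof.
set u := R (e 1) (e 3).
have [u1 u2] : co 1 u = 0 /\ co 2 u = 0.
  apply: rprod_co12; rewrite -/u.
  have -> : M u (e 1) = co 1 u *: e 3 + co 3 u *: e 4 by coords.
  by rewrite linearDl !linearZl_LR /= r33 r4x !scaler0 addr0 co0.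
have uE := row34 u1 u2.
have l31 : L (e 3) (e 1) = u by rewrite /u e3E rprod_mul.
have : L (co 3 u *: e 3 + co 4 u *: e 4) (e 1) = 0.
  by rewrite -uE /u lprod_rprodE; coords.
rewrite linearDl !linearZl_LR /= l31 l4x scaler0 addr0.
move/(congr1 (co 3)); rewrite coZ co0 => /eqP.
rewrite mulf_eq0 orbb => /eqP u3.
by exists (co 4 u); rewrite {1}uE u3 scale0r add0r.
Qed.

(** Knowing [r13], the operation [R (e 3)] has values in the line of [e 4], so
    that [rprod_co12] applies to all [x] and [y]. *)
Lemma ad_form_As48 : exists p q r b, ad_form B p q r b.
Proof.
have [k r13k] := r13.
have l31 : L (e 3) (e 1) = k *: e 4 by rewrite -r13k e3E rprod_mul.
have r31 : R (e 3) (e 1) = (1 - k) *: e 4.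
  apply: (addIr (L (e 3) (e 1))).
  by rewrite -ad_mulE m31 l31 -scalerDl subrK scale1r.
have r3 y : R (e 3) y = (co 1 y * (1 - k)) *: e 4.
  rewrite {1}[y]row4E !linearDr !linearZr_LR /= r31 r32 r33 rx4.
  by rewrite !scaler0 !addr0 scalerA.
have r12 x y : co 1 (R x y) = 0 /\ co 2 (R x y) = 0.
  apply: rprod_co12; set w := M _ x.
  have -> : w = co 3 w *: e 3 + co 4 w *: e 4 by apply: row34; rewrite ?ME.
  rewrite linearDl !linearZl_LR /= r3 r4x.
  by rewrite coD !coZ co0 co_e //= !mulr0 addr0.
have rE x y : R x y = co 3 (R x y) *: e 3 + co 4 (R x y) *: e 4.
  by have [h1 h2] := r12 x y; exact: row34.
have r3k x y : co 3 (R x y) * k = co 1 x * co 1 y.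
  have : co 4 (L (R x y) (e 1)) = co 1 x * co 1 y.
    by rewrite lprod_rprodE ?ME ?co_e //=; ring.
  rewrite {1}rE linearDl !linearZl_LR /= l31 l4x => <-.
  by rewrite !coE co_e //= co0; ring.
(* [R (e 1) (R (e 1) (e 1)) = - R (e 3) (e 1)] reads [1 = k - 1], because
   [r3k] gives [co 3 (R (e 1) (e 1)) * k = 1]. *)
have k2 : k = 2.
  have := rprod_rprodE B (e 1) (e 1) (e 1).
  rewrite -e3E r31 [R (e 1) (e 1)]rE linearDr !linearZr_LR /= r13k rx4.
  move/(congr1 (co 4)); rewrite !coE co0 co_e //= !mulr1 mulr0 addr0 r3k.
  rewrite co_e //= mulr1 opprB => /eqP.
  by rewrite eq_sym subr_eq => /eqP ->; ring.
have r3E x y : co 3 (R x y) = 2^-1 * (co 1 x * co 1 y).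
  by rewrite -r3k k2 mulrCA mulVf ?pnatr_eq0 // mulr1.
pose p := co 4 (R (e 1) (e 1)); pose q := co 4 (R (e 1) (e 2)).
pose r := co 4 (R (e 2) (e 1)); pose b := 1 + co 4 (R (e 2) (e 2)).
have r4E x y : co 4 (R x y) = p * (co 1 x * co 1 y) + q * (co 1 x * co 2 y) +
    2 * (co 1 x * co 3 y) + r * (co 2 x * co 1 y) +
    (-1 + b) * (co 2 x * co 2 y) + (-1) * (co 3 x * co 1 y).
  rewrite [in LHS](row4E x) [in LHS](row4E y).
  rewrite !(linearDr, linearDl, linearZl_LR, linearZr_LR) /=.
  rewrite !(r4x, rx4, r13k, r23, r3) !(coD, coZ) !co0 !co_e //= k2.
  by rewrite -/p -/q -/r /b; ring.
exists p, q, r, b; split=> x y.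
  by have [h1 h2] := r12 x y; split.
have [h1 h2] := r12 x y.
rewrite LE; split; rewrite coD coN ME ?h1 ?h2 ?r3E ?r4E ?subr0 //;
  by field.
Qed.
End Structure.

(** * Isomorphisms between structures in normal form *)

Section Isomorphisms.
Variable K : numFieldType.
Local Notation E := 'rV[K]_4.
Local Notation e := (@e K).

(** [product_form] as a rewriting rule. *)
Lemma product_formE (op : E -> E -> E) t p q c r s d :
  product_form op t p q c r s d ->
  (forall x y, co 1 (op x y) = 0) * (forall x y, co 2 (op x y) = 0) *
  (forall x y, co 3 (op x y) = t * (co 1 x * co 1 y)) *
  (forall x y, co 4 (op x y) = p * (co 1 x * co 1 y) +
    q * (co 1 x * co 2 y) + c * (co 1 x * co 3 y) + r * (co 2 x * co 1 y) +
    s * (co 2 x * co 2 y) + d * (co 3 x * co 1 y)).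
Proof.
by move=> h; split; [split; [split|]|] => x y; case: (h x y).
Qed.

Definition row4 (a b c d : K) : E := a *: e 1 + b *: e 2 + c *: e 3 + d *: e 4.

Lemma co_row4 a b c d :
  (co 1 (row4 a b c d) = a) * (co 2 (row4 a b c d) = b) *
  (co 3 (row4 a b c d) = c) * (co 4 (row4 a b c d) = d).
Proof. by do !split; rewrite !coE !co_e //=; ring. Qed.

(** The automorphism of As48 with [e 1 |-> t^2 e 1 + t^3 m e 2] and
    [e 2 |-> t^3 e 2 + t^4 m e 3]: the shear of parameter [m] followed by the
    dilation with weights [2, 3, 4, 6]. *)
Definition base_change (t m : K) (x : E) : E :=
  row4 (t ^+ 2 * co 1 x) (t ^+ 3 * (m * co 1 x + co 2 x))
    (t ^+ 4 * (m * co 2 x + co 3 x)) (t ^+ 6 * (co 4 x - m ^+ 2 * co 3 x)).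

Fact base_change_linear t m : linear (base_change t m).
Proof.
by move=> a x y; apply: rowP4; rewrite !(coD, coZ, co_row4); ring.
Qed.

HB.instance Definition _ t m :=
  GRing.isLinear.Build K E E *:%R (base_change t m) (base_change_linear t m).

Lemma base_change_bij t m : t != 0 -> bijective (base_change t m).
Proof.
move=> t0.
pose g (y : E) := let x1 := co 1 y / t ^+ 2 in
  let x2 := co 2 y / t ^+ 3 - m * x1 in let x3 := co 3 y / t ^+ 4 - m * x2 in
  row4 x1 x2 x3 (co 4 y / t ^+ 6 + m ^+ 2 * x3).
by exists g => x; apply: rowP4; rewrite !co_row4; field.
Qed.

(** For the direct implication, an isomorphism [f] is an automorphism of As48.
    With [f1 := f (e 1)] and [f2 := f (e 2)], the relation
    [e 2 * e 2 = - e 4] gives [co 1 f2 = 0] and [(co 2 f2)^2 = (co 1 f1)^3], so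
    that [t := co 2 f2 / co 1 f1] is a common parameter of these two
    coordinates, and [e 1 * e 2 = 0] determines [co 3 f2].  The invariance of
    [R] on the products of [e 1] and [e 2], read in coordinate 4, then gives
    the four equations; [co 3 f1] is free and cancels out. *)
Lemma ad_form_iso (B B' : antiDendriform E) (p q r b p' q' r' b' : K) :
  ad_form B p q r b -> ad_form B' p' q' r' b' ->
  ad_iso B B' <-> exists2 t, t != 0 & exists m,
    [/\ b' = b, q' = t * (q - (b + 1) * m), r' = t * (r - (b - 2) * m) &
      p' = t ^+ 2 * (p - (q + r) * m + (b - 2^-1) * m ^+ 2)].
Proof.
move=> [/product_formE Rf /product_formE Lf].
move=> [/product_formE Rf' /product_formE Lf'].
split=> [[f bf [fr fl]]|[t t0 [m [bE qE rE pE]]]]; last first.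
  subst b' q' r' p'.
  exists (base_change t m); first exact: base_change_bij.
  by split=> x y; apply: rowP4; rewrite /= /base_change co_row4 ?Rf' ?Lf'
    ?co_row4 ?Rf ?Lf; field.
have fM x y : f (ad_mul B x y) = ad_mul B' (f x) (f y).
  by rewrite !ad_mulE linearD fr fl.
have M3 x y : co 3 (ad_mul B' x y) = co 1 x * co 1 y.
  by rewrite ad_mulE coD Rf' Lf'; field.
have M4 x y : co 4 (ad_mul B' x y) =
    co 1 x * co 3 y - co 2 x * co 2 y + co 3 x * co 1 y.
  by rewrite ad_mulE coD Rf' Lf'; ring.
have M12 x y : co 1 (ad_mul B' x y) = 0 /\ co 2 (ad_mul B' x y) = 0.
  by rewrite ad_mulE !coD !Rf' !Lf' !addr0.
have e3E : e 3 = ad_mul B (e 1) (e 1).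
  by apply: rowP4; rewrite ad_mulE coD Rf Lf ?co_e //=; field.
have e4E : e 4 = ad_mul B (e 1) (e 3).
  by apply: rowP4; rewrite ad_mulE coD Rf Lf ?co_e //=; ring.
have e22 : - e 4 = ad_mul B (e 2) (e 2).
  by apply: rowP4; rewrite ad_mulE !coD coN Rf Lf ?co_e //=; ring.
have e12 : 0 = ad_mul B (e 1) (e 2).
  by apply: rowP4; rewrite ad_mulE !coD co0 Rf Lf ?co_e //=; ring.
have f3 := congr1 f e3E; have f4 := congr1 f e4E.
have f22 := congr1 f e22; have f12 := congr1 f e12.
rewrite !fM ?linear0 ?linearN in f3 f4 f22 f12.
set f1 := f (e 1) in f3 f4 f22 f12; set f2 := f (e 2) in f3 f4 f22 f12.
have [f31 f32] : co 1 (f (e 3)) = 0 /\ co 2 (f (e 3)) = 0 by rewrite f3.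
have f33 : co 3 (f (e 3)) = co 1 f1 ^+ 2 by rewrite f3 M3.
have f34 : co 4 (f (e 3)) = 2 * (co 1 f1 * co 3 f1) - co 2 f1 ^+ 2.
  by rewrite f3 M4; ring.
have [f41 f42] : co 1 (f (e 4)) = 0 /\ co 2 (f (e 4)) = 0 by rewrite f4.
have f43 : co 3 (f (e 4)) = 0 by rewrite f4 M3 f31 mulr0.
have f44 : co 4 (f (e 4)) = co 1 f1 ^+ 3.
  by rewrite f4 M4 f31 f32 f33; ring.
have l0 : co 1 f1 != 0.
  apply/eqP => l0; have : e 4 = 0.
    apply: (bij_inj bf); rewrite linear0.
    by apply: rowP4; rewrite co0 ?f41 ?f42 ?f43 ?f44 // l0 expr0n.
  by move/(congr1 (co 4))/eqP; rewrite co_e //= co0 oner_eq0.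
have x0 : co 1 f2 = 0.
  have /eqP := congr1 (co 3) f22.
  by rewrite coN f43 M3 oppr0 eq_sym mulf_eq0 orbb => /eqP.
have y2 : co 2 f2 ^+ 2 = co 1 f1 ^+ 3.
  have := congr1 (co 4) f22.
  by rewrite coN f44 M4 x0 mul0r mulr0 addr0 sub0r => /oppr_inj ->.
have zE : co 1 f1 * co 3 f2 = co 2 f1 * co 2 f2.
  have := congr1 (co 4) f12.
  by rewrite co0 M4 x0 mulr0 addr0 => /esym/eqP; rewrite subr_eq0 => /eqP.
have y0 : co 2 f2 != 0 by rewrite -sqrf_eq0 y2 expf_neq0.
pose t := co 2 f2 / co 1 f1; pose m := co 2 f1 / co 2 f2.
have t0 : t != 0 by rewrite mulf_neq0 ?invr_eq0.
have lE : co 1 f1 = t ^+ 2.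
  by rewrite expr_div_n y2 exprS mulfK ?expf_neq0.
have yE : co 2 f2 = t ^+ 3.
  by rewrite exprS -lE divfK.
have uE : co 2 f1 = m * t ^+ 3 by rewrite -yE divfK.
have {}zE : co 3 f2 = m * t ^+ 4.
  by apply: (mulfI l0); rewrite zE uE yE lE; ring.
have lincomb (c a a' x x' : K) :
    c != 0 -> a = a' -> (x - x') * c = a' - a -> x = x'.
  move=> c0 -> /eqP; rewrite subrr mulf_eq0 (negPf c0) orbF subr_eq0.
  by move/eqP.
have f_e34 (x : E) : x = co 3 x *: e 3 + co 4 x *: e 4 ->
    co 4 (f x) = co 3 x * co 4 (f (e 3)) + co 4 x * t ^+ 6.
  move=> xE; rewrite {1}xE linearD !linearZ coD !coZ f44 lE.
  by rewrite -exprM.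
have R34 x y :
    rprod B x y = co 3 (rprod B x y) *: e 3 + co 4 (rprod B x y) *: e 4.
  by apply: rowP4; rewrite !coE !co_e // ?Rf //=; ring.
have R4 x y : co 4 (f (rprod B x y)) = co 4 (rprod B' (f x) (f y)).
  by rewrite fr.
have := R4 (e 2) (e 2); have := R4 (e 1) (e 1).
have := R4 (e 1) (e 2); have := R4 (e 2) (e 1).
rewrite !(f_e34 _ (R34 _ _)) !Rf !Rf' -/f1 -/f2 f34 x0 yE zE uE lE !co_e //=.
move=> E21 E12 E11 E22.
have bE : b' = b by apply: (lincomb _ _ _ _ _ (expf_neq0 6 t0) E22); ring.
rewrite bE in E21 E12 E11.
have qE : q' = t * (q - (b + 1) * m).
  by apply: (lincomb _ _ _ _ _ (expf_neq0 5 t0) E12); ring.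
have rE : r' = t * (r - (b - 2) * m).
  by apply: (lincomb _ _ _ _ _ (expf_neq0 5 t0) E21); ring.
exists t => //; exists m; split=> //.
rewrite qE rE in E11.
by apply: (lincomb _ _ _ _ _ (expf_neq0 4 t0) E11); field.
Qed.
End Isomorphisms.

(** * Classification *)

Section Classification.
Variable K : numClosedFieldType.

Definition listed_p (t : listed K) : K :=
  match t with L21 _ _ | L23 _ => 1 | _ => 0 end.
Definition listed_q (t : listed K) : K :=
  match t with L22 => 1 | L23 a => a | _ => 0 end.
Definition listed_r (t : listed K) : K :=
  match t with L20 _ => 1 | L21 a _ => a | _ => 0 end.
Definition listed_b (t : listed K) : K :=
  match t with L19 a | L20 a => a | L21 _ b => b | L22 | L23 _ => -1 end.

Lemma ad_form_listed t :
  ad_form (AD t) (listed_p t) (listed_q t) (listed_r t) (listed_b t).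
Proof.
case: t => [a|a|a b||a]; split.
- exact: AD19_r_form.
- exact: AD19_l_form.
- exact: AD20_r_form.
- exact: AD20_l_form.
- exact: AD21_r_form.
- exact: AD21_l_form.
- exact: AD22_r_form.
- exact: AD22_l_form.
- exact: AD23_r_form.
- exact: AD23_l_form.
Qed.

(** Rescaling [p] to [1] takes a square root, since [p] has weight 2. *)
Lemma sqr_scale (x : K) : x != 0 -> exists2 t, t != 0 & t ^+ 2 * x = 1.
Proof.
move=> x0; exists (sqrtC x^-1); first by rewrite sqrtC_eq0 invr_eq0.
by rewrite sqrtCK mulVf.
Qed.

(** Below, [m] is the shear which kills [r] when [b = -1] and [q] otherwise,
    and [p0], [r0] are the values of [p] and [r] after this shear. *)
Lemma ad_form_classify (B : antiDendriform 'rV[K]_4) p q r b :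
  ad_form B p q r b -> exists2 t, admissible t & ad_iso B (AD t).
Proof.
move=> Bf.
have iso t (h : admissible t) m s : s != 0 ->
    [/\ listed_b t = b, listed_q t = s * (q - (b + 1) * m),
      listed_r t = s * (r - (b - 2) * m) &
      listed_p t = s ^+ 2 * (p - (q + r) * m + (b - 2^-1) * m ^+ 2)] ->
    exists2 t, admissible t & ad_iso B (AD t).
  move=> s0 E; exists t => //.
  by apply/(ad_form_iso Bf (ad_form_listed t)); exists s => //; exists m.
have [b1|b1] := eqVneq b (-1).
  have n3 : 3 != 0 :> K by rewrite pnatr_eq0.
  pose m := - r / 3; pose p0 := p - (q + r) * m + (b - 2^-1) * m ^+ 2.
  have r0 s : s * (r - (b - 2) * m) = 0 by rewrite /m b1; field.
  have q0 s : s * (q - (b + 1) * m) = s * q by rewrite b1; ring.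
  have [p00|/sqr_scale[s s0 p1]] := eqVneq p0 0.
    have [q00|qN0] := eqVneq q 0.
      apply: (iso (L19 b) isT m 1); first exact: oner_neq0.
      by rewrite q0 r0 -/p0 p00 q00 !mulr0.
    apply: (iso (L22 K) isT m q^-1); first by rewrite invr_eq0.
    by rewrite q0 r0 -/p0 p00 mulr0 mulVf.
  by apply: (iso (L23 (s * q)) isT m s) => //; rewrite q0 r0 -/p0 p1.
have b10 : b + 1 != 0 by rewrite addr_eq0.
pose m := q / (b + 1); pose p0 := p - (q + r) * m + (b - 2^-1) * m ^+ 2.
pose r0 := r - (b - 2) * m.
have q0 s : s * (q - (b + 1) * m) = 0 by rewrite /m; field.
have [p00|/sqr_scale[s s0 p1]] := eqVneq p0 0.
  have [r00|rN0] := eqVneq r0 0.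
    apply: (iso (L19 b) isT m 1); first exact: oner_neq0.
    by rewrite q0 -/r0 -/p0 p00 r00 !mulr0.
  apply: (iso (L20 b) b1 m r0^-1); first by rewrite invr_eq0.
  by rewrite q0 -/r0 -/p0 p00 mulr0 mulVf.
by apply: (iso (L21 (s * r0) b) b1 m s) => //; rewrite q0 -/r0 -/p0 p1.
Qed.

Lemma listed_q0 t : listed_b t != -1 -> listed_q t = 0.
Proof. by case: t => [a|a|a b||a] //=; rewrite eqxx. Qed.

Lemma listed_r0 t : admissible t -> listed_b t = -1 -> listed_r t = 0.
Proof. by case: t => //= [a|a b] /eqP. Qed.

(** In the list, the scalar that a shear could move, [q] or [r] according to
    [b], is zero on both sides.  Hence the shear is trivial and only the
    dilation by [s] is left. *)
Lemma ad_iso_same_listed (t u : listed K) :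
  admissible t -> admissible u -> ad_iso (AD t) (AD u) -> same_listed t u.
Proof.
move=> ht hu /(ad_form_iso (ad_form_listed t) (ad_form_listed u)).
move=> [s s0 [m [bE qE rE pE]]].
have m0 : m = 0.
  have [b1|b1] := eqVneq (listed_b t) (-1).
    move: rE; rewrite !listed_r0 ?bE // b1 => /esym/eqP.
    have -> : s * (0 - (-1 - 2) * m) = s * (3 * m) by ring.
    by rewrite !mulf_eq0 (negPf s0) pnatr_eq0 => /eqP.
  move: qE; rewrite !listed_q0 ?bE // sub0r => /esym/eqP.
  by rewrite mulf_eq0 oppr_eq0 mulf_eq0 addr_eq0 (negPf s0) (negPf b1) => /eqP.
have {}qE : listed_q u = s * listed_q t by rewrite qE m0; ring.
have {}rE : listed_r u = s * listed_r t by rewrite rE m0; ring.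
have {}pE : listed_p u = s ^+ 2 * listed_p t by rewrite pE m0; ring.
have sgn (a a' : K) : a' = s * a -> 1 = s ^+ 2 -> a = a' \/ a = - a'.
  move=> -> /esym/eqP; rewrite sqrf_eq1 => /orP[]/eqP->; [left|right]; ring.
have false_of (x y : K) : x = y -> (x == y) = false -> False.
  by move=> ->; rewrite eqxx.
case: t u ht hu bE qE rE pE => [a|a|a b||a] [a'|a'|a' b'||a'] //=
  ht hu bE qE rE pE; try by [].
(* Different families differ by the vanishing of [p], [q] or [r], except for
   21 and 23, which are separated by [b]. *)
all: try by [apply: (false_of _ _ pE);
  rewrite ?mulr0 ?mulr1 ?oner_eq0 // eq_sym ?expf_eq0 ?(negPf s0)].
all: try by [apply: (false_of _ _ qE);
  rewrite ?mulr0 ?mulr1 ?oner_eq0 // eq_sym (negPf s0)].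
all: try by [apply: (false_of _ _ rE);
  rewrite ?mulr0 ?mulr1 ?oner_eq0 // eq_sym (negPf s0)].
all: rewrite ?mulr1 in pE; try by [split=> //; exact: sgn | exact: sgn].
- by rewrite -bE eqxx in ht.
- by rewrite bE eqxx in hu.
Qed.
End Classification.

Theorem theorem3p3 (R : realType) :
  (forall (V : vectType R[i]) (A : antiDendriform V),
     \dim {:V} = 4%N -> associated_to A (As48 R[i]) ->
     exists2 t : listed R[i], admissible t & ad_iso A (AD t)) /\
  (forall t u : listed R[i], admissible t -> admissible u ->
     ~ same_listed t u -> ~ ad_iso (AD t) (AD u)).
Proof.
split=> [V A _ [f [g fK gK] fM]|t u ht hu neq_tu]; last first.
  by move/(ad_iso_same_listed ht hu).
have [B [fr fl AB]] := ad_transport fK gK A.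
have mulE x y : ad_mul B x y = table_mul (As48_table R[i]) x y.
  have <- : f (g x) = x by [].
  have <- : f (g y) = y by [].
  rewrite ad_mulE -fr -fl -linearD -ad_mulE.
  exact: fM.
have [p [q [r [b Bf]]]] := ad_form_As48 mulE.
have [t ht Bt] := ad_form_classify Bf.
by exists t => //; apply: ad_iso_trans Bt.
Qed.
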